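(* Let $1\le k<N/2$ and $l_1<l_2$. Consider identifying an unknown $x\in\{0,1\}^N$ with $wt(x)=k$ using the balance oracle under the restriction that every query string (in every superposition) places either at most $l_1$ coins or at least $l_2$ coins on the pans. Then every quantum algorithm that identifies $x$ with bounded error needs $\Omega\big(\min((N/(l_1k))^{1/2},(l_2k/N)^{1/4})\big)$ queries. In particular, for any $\epsilon\ge0$, if every query places at most $N/k^{1+2\epsilon}$ or at least $N/k^{1-4\epsilon}$ coins on the pans, then $\Omega(k^{\epsilon})$ queries are needed.
   Context: Counterfeit coin model: $x\in\{0,1\}^N$, $x_i=1$ meaning coin $i$ is false; $k=wt(x)$ (Hamming weight) is known and $k<N/2$. Queries are strings $q\in\{0,1,-1\}^N$ with equally many entries $1$ and $-1$ ($1$: left pan, $-1$: right pan, $0$: not weighed); $\chi(x;q)=0$ if $\sum_iq_ix_i=0$ (balanced) and $1$ otherwise. The balance oracle is the unitary $|q\rangle\mapsto(-1)^{\chi(x;q)}|q\rangle$ (equivalently $|q,a\rangle\mapsto|q,a\oplus\chi(x;q)\rangle$). The number of coins a query places on the pans is its number of nonzero entries. Bounded error: output equals $x$ with probability at least a constant such as $2/3$ for every admissible $x$. *)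

(* Defs.v *)
From HB Require Import structures.
From mathcomp Require Import all_boot all_order all_algebra.
From mathcomp Require Import reals exp.
From mathcomp Require Import complex.
Set Implicit Arguments. Unset Strict Implicit. Unset Printing Implicit Defensive.
Import Order.TTheory GRing.Theory Num.Theory.
Local Open Scope ring_scope.

(* A pan entry is encoded by 'I_3 : 0 |-> 0 (not weighed), 1 |-> 1 (left pan),
   2 |-> -1 (right pan). *)
Definition pan_val (a : 'I_3) : int :=
  if val a == 0%N then 0 else if val a == 1%N then 1 else -1.

Definition qstring (N : nat) := {ffun 'I_N -> 'I_3}.

Definition ncoins N (q : qstring N) : nat := #|[pred i | pan_val (q i) != 0]|.

Definition balanced_query N (q : qstring N) : bool :=
  #|[pred i | pan_val (q i) == 1]| == #|[pred i | pan_val (q i) == -1]|.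

Definition wt N (x : {ffun 'I_N -> bool}) : nat := #|[pred i | x i]|.

Definition chi N (x : {ffun 'I_N -> bool}) (q : qstring N) : bool :=
  (\sum_(i < N) pan_val (q i) * (x i)%:Z) != 0.

(* The admissible query strings: legal queries whose number of coins satisfies
   the restriction P. The query register of the algorithm has exactly these
   strings as computational basis, so every query string in every
   superposition obeys the restriction. *)
Definition Query N (P : pred nat) :=
  {q : qstring N | balanced_query q && P (ncoins q)}.

Definition coin_restr (l1 l2 : nat) : pred nat := fun n => (n <= l1)%N || (l2 <= n)%N.

(* Computational basis of the whole space: query register (x) workspace of
   dimension m. *)
Definition St N (P : pred nat) (m : nat) := (Query N P * 'I_m)%type.

Section Quantum.
Variable C : numClosedFieldType.

Definition apply_op (S : finType) (U : S -> S -> C) (v : S -> C) : S -> C :=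
  fun s => \sum_(t : S) U s t * v t.

(* U^dagger U = I (equivalent to unitarity in finite dimension) *)
Definition unitary (S : finType) (U : S -> S -> C) : Prop :=
  forall s t : S, \sum_(r : S) (U r s)^* * U r t = (s == t)%:R.

Definition normalized (S : finType) (v : S -> C) : Prop :=
  \sum_(s : S) `|v s| ^+ 2 = 1.

Definition oracle N P m (x : {ffun 'I_N -> bool}) (v : St N P m -> C) :
  St N P m -> C :=
  fun s => (if chi x (val s.1) then -1 else 1) * v s.

Fixpoint run N P m (U : nat -> St N P m -> St N P m -> C) (psi0 : St N P m -> C)
  (x : {ffun 'I_N -> bool}) (i : nat) : St N P m -> C :=
  match i with
  | 0 => apply_op (U 0%N) psi0
  | i'.+1 => apply_op (U i) (oracle x (run U psi0 x i'))
  end.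

Definition success_prob N P m T (U : nat -> St N P m -> St N P m -> C)
  (psi0 : St N P m -> C) (out : St N P m -> {ffun 'I_N -> bool})
  (x : {ffun 'I_N -> bool}) : C :=
  \sum_(s : St N P m | out s == x) `|run U psi0 x T s| ^+ 2.

Definition identifies_wt N k P m T (U : nat -> St N P m -> St N P m -> C)
  (psi0 : St N P m -> C) (out : St N P m -> {ffun 'I_N -> bool}) : Prop :=
  [/\ normalized psi0,
      (forall i, (i <= T)%N -> unitary (U i)) &
      forall x : {ffun 'I_N -> bool}, wt x = k ->
        2%:R / 3%:R <= success_prob T U psi0 out x].

End Quantum.

(* Main.v *)
Require Import Defs.
From HB Require Import structures.
From mathcomp Require Import all_boot all_order all_algebra.
From mathcomp Require Import reals exp.
From mathcomp Require Import complex.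
From mathcomp Require Import zify ring lra.
Set Implicit Arguments. Unset Strict Implicit. Unset Printing Implicit Defensive.
Import Order.TTheory GRing.Theory Num.Theory.

(* A hybrid argument.  Small queries are almost always balanced and
   large ones almost never, so the algorithm is compared with its
   run against a reference oracle, independent of x, that answers "balanced" on
   small queries and "unbalanced" on large ones.  If p bounds the probability,
   over a uniformly random x of weight k, that the two answers differ on a given
   query, then the mean squared distance between the two final states is at most
   4 T^2 p, whence T^2 p >= 1/72.  For a query with l coins, p <= l k / N for
   the answer "balanced", by a union bound.  For the answer "unbalanced",
   p <= 2 (N / (l k))^(1/2): conditionally on the number j of false coins on the
   pans, the probability r(j) of an even split satisfies
   r(j)^2 <= 2 (1/(j+1) + 1/(l-j+1)), and Vandermonde's identity evaluates the
   mean of the right-hand side; Cauchy-Schwarz then bounds the mean of r. *)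

(** * Binomial estimates and a Cauchy-Schwarz inequality over the naturals *)

Lemma central_binS n : 'C(2 * n.+1, n.+1) * n.+1 = 'C(2 * n, n) * (2 * (2 * n).+1).
Proof.
have eC : 'C((2 * n).+1, n.+1) = 'C((2 * n).+1, n).
  by rewrite -bin_sub; [congr 'C(_, _); lia | lia].
have /= e := mul_bin_diag (2 * n).+1 n.
rewrite (_ : 2 * n.+1 = (2 * n).+2); last lia.
by rewrite binS -eC; nia.
Qed.

(** With [central_bin_lb], this places 'C(2n, n) between 4^n / sqrt(4n+1) and 4^n / sqrt(2n+1),
    squared to stay in [nat]. *)
Lemma central_bin_ub n : 'C(2 * n, n) ^ 2 * (2 * n).+1 <= 16 ^ n.
Proof.
elim: n => [|n IHn] //.
rewrite -(leq_pmul2r (_ : 0 < n.+1 ^ 2)) ?expn_gt0 // mulnAC -expnMn central_binS.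
set c := 'C(_, _) in IHn *; rewrite (expnSr 16).
have h : (2 * n).+1 * (2 * n.+1).+1 <= 4 * n.+1 ^ 2 by nia.
have le := leq_mul (leq_mul IHn (leqnn 4)) h.
by apply: leq_trans (leq_trans _ le) _; apply: eq_leq; ring.
Qed.

Lemma central_bin_lb n : 16 ^ n <= 'C(2 * n, n) ^ 2 * (4 * n).+1.
Proof.
elim: n => [|n IHn] //.
rewrite -(leq_pmul2r (_ : 0 < n.+1 ^ 2)) ?expn_gt0 // mulnAC -expnMn central_binS.
set c := 'C(_, _) in IHn *; rewrite (expnSr 16).
have h : 16 * (4 * n).+1 * n.+1 ^ 2 <= 4 * (2 * n).+1 ^ 2 * (4 * n.+1).+1 by nia.
rewrite -(leq_pmul2r (_ : 0 < (4 * n).+1)) //.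
have le := leq_mul IHn h.
by apply: leq_trans (leq_trans _ le) _; apply: eq_leq; ring.
Qed.

(** Both sides are the multinomial coefficient (2(i+j))! / (i! j!)^2: splitting into halves first,
    or choosing the 2i elements first. *)
Lemma bin_sqr_central i j :
  'C(i + j, i) ^ 2 * 'C(2 * (i + j), i + j)
  = 'C(2 * (i + j), 2 * i) * 'C(2 * i, i) * 'C(2 * j, j).
Proof.
have := @bin_fact (i + j) i (leq_addr _ _); rewrite addKn => e1.
have := @bin_fact (2 * (i + j)) (i + j) ltac:(lia).
rewrite (_ : 2 * (i + j) - (i + j) = i + j); last lia.
move=> e2.
have := @bin_fact (2 * (i + j)) (2 * i) ltac:(lia).
rewrite (_ : 2 * (i + j) - 2 * i = 2 * j); last lia.
move=> e3.
have := @bin_fact (2 * i) i ltac:(lia).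
rewrite (_ : 2 * i - i = i); last lia.
move=> e4.
have := @bin_fact (2 * j) j ltac:(lia).
rewrite (_ : 2 * j - j = j); last lia.
move=> e5.
apply/eqP; rewrite -(eqn_pmul2r (_ : 0 < (i`! * j`!) ^ 2)); last first.
  by rewrite expn_gt0 muln_gt0 !fact_gt0.
apply/eqP; rewrite mulnAC -expnMn e1 -mulnn mulnC e2 -e3 -e4 -e5.
ring.
Qed.

(** Absorbs a weight 1/((a+1)(b+1)) into a binomial coefficient, so that weighted sums remain of
    Vandermonde type. *)
Lemma binSS_central a b :
  'C((a + b).+2, a.+1) * (a.+1 * b.+1) = (a + b).+2 * (a + b).+1 * 'C(a + b, a).
Proof.
have := mul_bin_diag (a + b).+2 a; rewrite /= => e1.
have := mul_bin_down (a + b).+1 a; rewrite /= (_ : (a + b).+1 - a = b.+1); last lia.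
move=> e2; rewrite mulnA (mulnC _ a.+1) -e1 -!mulnA e2; ring.
Qed.

(* 'C(i + j, i)^2 / 'C(2(i + j), 2i) is the probability that a uniformly random
   set of 2i coins splits evenly between two pans of i + j coins each. *)
Lemma bin_balance i j :
  (2 * (i + j)).+1 * 'C(i + j, i) ^ 4
  <= 'C(2 * (i + j), 2 * i) * (2 * 'C((2 * (i + j)).+2, (2 * i).+1)).
Proof.
have e1 := bin_sqr_central i j.
have := binSS_central (2 * i) (2 * j); rewrite -mulnDr => e2.
have le1 := leq_mul (central_bin_ub i) (central_bin_ub j).
rewrite -expnD in le1.
have le2 := leq_trans le1 (central_bin_lb (i + j)).
set A := 'C(i + j, i) in e1 *; set W := 'C(2 * (i + j), 2 * i) in e1 e2 *.
set V := 'C(_.+2, _) in e2 *.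
have c0 : 0 < 'C(2 * (i + j), i + j) by rewrite bin_gt0; lia.
set c := 'C(2 * (i + j), i + j) in c0 e1 le2.
(* Multiplying by [c ^ 2] turns [A ^ 4] into the square of the right-hand side of [bin_sqr_central],
   to which the central bounds apply. *)
have le3 : A ^ 4 * ((2 * i).+1 * (2 * j).+1) <= W ^ 2 * (4 * (i + j)).+1.
  rewrite -(leq_pmul2r (_ : 0 < c ^ 2)) ?expn_gt0 ?c0 //.
  have le4 := leq_mul (leqnn (W ^ 2)) le2.
  rewrite (_ : A ^ 4 * _ * c ^ 2 = (A ^ 2 * c) ^ 2 * ((2 * i).+1 * (2 * j).+1)); last ring.
  rewrite e1; apply: leq_trans (leq_trans le4 _); apply: eq_leq; ring.
rewrite -(leq_pmul2r (_ : 0 < (2 * i).+1 * (2 * j).+1)) //.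
rewrite -mulnA (leq_trans (leq_mul (leqnn _) le3)) //.
rewrite (_ : W * (2 * V) * _ = 2 * W * (V * ((2 * i).+1 * (2 * j).+1))); last ring.
rewrite e2; nia.
Qed.

(** Twice each side is a double sum over pairs, compared termwise: c a_i a_j is at most the
    geometric mean of w_i v_j and w_j v_i, hence at most their arithmetic mean. *)
Lemma sum_cauchy_schwarz (I : finType) (P : pred I) (c : nat) (a w v : I -> nat) :
  (forall i, P i -> c * a i ^ 2 <= w i * v i) ->
  c * (\sum_(i | P i) a i) ^ 2 <= (\sum_(i | P i) w i) * (\sum_(i | P i) v i).
Proof.
move=> le_wv; rewrite -(leq_pmul2l (_ : 0 < 2)) //.
have -> : 2 * (c * (\sum_(i | P i) a i) ^ 2)
    = \sum_(i | P i) \sum_(j | P j) 2 * (c * (a i * a j)).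
  rewrite -mulnn big_distrlr /= !big_distrr; apply: eq_bigr => i _.
  by rewrite !big_distrr.
have -> : 2 * ((\sum_(i | P i) w i) * (\sum_(i | P i) v i))
    = \sum_(i | P i) \sum_(j | P j) (w i * v j + w j * v i).
  rewrite mul2n -addnn {2}big_distrlr big_distrlr /= [X in _ + X]exchange_big /=.
  by rewrite -big_split; apply: eq_bigr => i _; rewrite -big_split.
apply: leq_sum => i Pi; apply: leq_sum => j Pj.
rewrite -leq_sqr; apply: leq_trans (nat_AGM2 (w i * v j) (w j * v i)).
apply: (@leq_trans (4 * ((c * a i ^ 2) * (c * a j ^ 2)))).
  by apply: eq_leq; ring.
apply: (@leq_trans (4 * ((w i * v i) * (w j * v j)))).
  by rewrite leq_mul2l leq_mul ?le_wv.
by apply: eq_leq; ring.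
Qed.

(** * Counting sets by their intersections with the pans *)

(** The map X |-> (X :&: A, X :\: A) is a bijection onto pairs of independent choices. *)
Lemma card_subsets_split (T : finType) (Z A : {set T}) (P Q : pred {set T}) :
  A \subset Z ->
  #|[set X : {set T} | [&& X \subset Z, P (X :&: A) & Q (X :\: A)]]|
  = #|[set Y : {set T} | (Y \subset A) && P Y]|
    * #|[set Y : {set T} | (Y \subset Z :\: A) && Q Y]|.
Proof.
move=> AZ; rewrite -cardsX.
rewrite -(card_imset _ (_ : injective (fun X : {set T} => (X :&: A, X :\: A)))); last first.
  by move=> X Y [e1 e2]; rewrite -(setID X A) e1 e2 setID.
apply: eq_card => -[Y1 Y2]; rewrite !inE /=.
apply/imsetP/andP => [[X]|[/andP[Y1A PY1] /andP[Y2ZA QY2]]].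
  rewrite inE => /and3P[XZ PX QX] [-> ->].
  by rewrite subsetIr PX QX setSD.
have [Y2Z Y2A] : Y2 \subset Z /\ [disjoint Y2 & A].
  by move: Y2ZA; rewrite subsetD => /andP.
have eI : (Y1 :|: Y2) :&: A = Y1.
  rewrite setIUl (setIidPl Y1A) (_ : Y2 :&: A = set0) ?setU0 //.
  by apply/eqP; rewrite setI_eq0.
have eD : (Y1 :|: Y2) :\: A = Y2.
  rewrite setDUl (_ : Y1 :\: A = set0) ?set0U; last by apply/eqP; rewrite setD_eq0.
  by apply/setDidPl.
exists (Y1 :|: Y2); last by rewrite eI eD.
by rewrite inE eI eD PY1 QY2 subUset (subset_trans Y1A AZ) Y2Z.
Qed.

Lemma card_draws_split (T : finType) (A B : {set T}) (i j l : nat) :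
  [disjoint A & B] ->
  #|[set X : {set T} | [&& #|X :&: A| == i, #|X :&: B| == j & #|X| == i + j + l]]|
  = 'C(#|A|, i) * ('C(#|B|, j) * 'C(#|T| - (#|A| + #|B|), l)).
Proof.
move=> dAB.
have BA : B \subset setT :\: A by rewrite subsetD subsetT disjoint_sym.
transitivity #|[set X : {set T} | [&& X \subset setT, #|X :&: A| == i &
  (#|(X :\: A) :&: B| == j) && (#|(X :\: A) :\: B| == l)]]|.
  apply: eq_card => X; rewrite !inE subsetT /=.
  have eXB : (X :\: A) :&: B = X :&: B.
    apply/setP => y; rewrite !inE; case: (boolP (y \in B)) => yB; rewrite ?andbF //.
    by rewrite (disjointFl dAB yB).
  rewrite -(cardsID A X) -(cardsID B (X :\: A)) eXB.
  case: eqP => //= ->; case: eqP => //= ->.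
  by rewrite -addnA !eqn_add2l.
rewrite (@card_subsets_split _ setT A (fun Y => #|Y| == i)
  (fun Y => (#|Y :&: B| == j) && (#|Y :\: B| == l))) ?subsetT //.
rewrite cards_draws; congr (_ * _).
rewrite (@card_subsets_split _ (setT :\: A) B (fun Y => #|Y| == j) (fun Y => #|Y| == l)) //.
rewrite !cards_draws; congr (_ * 'C(_, _)).
rewrite setDDl setTD cardsCs setCK cardsU.
by rewrite (_ : A :&: B = set0) ?cards0 ?subn0 //; apply/eqP; rewrite setI_eq0.
Qed.

(** The balanced sets are sorted by the number j of their elements in the two pans, necessarily
    even; [bin_balance] bounds each class and [sum_cauchy_schwarz] adds the bounds up. *)
Lemma card_balanced_le (T : finType) (A B : {set T}) (k : nat) :
  [disjoint A & B] -> #|A| = #|B| -> 2 * k < #|T| ->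
  #|[set X : {set T} | (#|X| == k) && (#|X :&: A| == #|X :&: B|)]| ^ 2
    * ((#|A| + #|B|) * k)
  <= 4 * #|T| * 'C(#|T|, k) ^ 2.
Proof.
move=> dAB eAB kN; set h := #|A| in eAB *; set N := #|T| in kN *.
have hN : 2 * h <= N.
  rewrite mul2n -addnn {2}eAB -(cardsUI A B) (_ : A :&: B = set0).
    by rewrite cards0 addn0 max_card.
  by apply/eqP; rewrite setI_eq0.
(* For j elements on the pans, [a] counts the balanced sets and [w] all sets; for j <= 2h, [v] is
   [w] times 2(2h+1)(1/(j+1) + 1/(2h-j+1)), rewritten as in [binSS_central]. *)
pose a (j : 'I_k.+1) := 'C(h, j./2) ^ 2 * 'C(N - 2 * h, k - j).
pose w (j : 'I_k.+1) := 'C(2 * h, j) * 'C(N - 2 * h, k - j).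
pose v (j : 'I_k.+1) := 2 * ('C((2 * h).+2, j.+1) * 'C(N - 2 * h, k - j)).
set S := [set X : {set T} | _].
have leX (X : {set T}) : #|X :&: A| = #|X :&: B| -> 2 * #|X :&: A| <= #|X|.
  move=> e; rewrite mul2n -addnn {2}e -cardsUI (_ : _ :&: (X :&: B) = set0).
    by rewrite cards0 addn0 -setIUr subset_leq_card ?subsetIl.
  by apply/eqP; rewrite -setI_eq0 in dAB; rewrite setIACA (eqP dAB) setI0.
have cardS : #|S| = \sum_(j < k.+1 | ~~ odd j) a j.
  rewrite -sum1_card.
  rewrite (partition_big (fun X : {set T} => inord (2 * #|X :&: A|) : 'I_k.+1)
    (fun j : 'I_k.+1 => ~~ odd j)) /=; last first.
    move=> X; rewrite inE => /andP[/eqP Xk /eqP e].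
    by rewrite inordK ?ltnS -?Xk ?leX // mul2n odd_double.
  apply: eq_bigr => j ev_j; rewrite sum1_card.
  have jk : j <= k by rewrite -ltnS.
  have ej : j./2 + j./2 = j by rewrite addnn -[RHS]odd_double_half (negbTE ev_j).
  rewrite /a -mulnn -mulnA {2}eAB (_ : 2 * h = #|A| + #|B|); last by rewrite -eAB; lia.
  rewrite -card_draws_split // ej subnKC //; apply: eq_card => X.
  rewrite [in RHS]inE unfold_in /= inE.
  case: (eqVneq #|X| k) => Xk /=; last by rewrite !andbF.
  rewrite andbT; case: (eqVneq #|X :&: A| #|X :&: B|) => e /=.
    rewrite -e andbb -val_eqE /= inordK; last by rewrite ltnS -Xk leX.
    lia.
  by apply/esym/negP => /andP[/eqP e1 /eqP e2]; rewrite e1 e2 eqxx in e.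
have le_wv (j : 'I_k.+1) : ~~ odd j -> (2 * h).+1 * a j ^ 2 <= w j * v j.
  move=> ev_j; rewrite /a /w /v; set M := 'C(N - _, _).
  have ej : 2 * j./2 = j by rewrite mul2n -[RHS]odd_double_half (negbTE ev_j).
  have [hj|jh] := ltnP h j./2; first by rewrite (bin_small hj) exp0n ?mul0n ?exp0n ?muln0.
  have := bin_balance j./2 (h - j./2); rewrite subnKC // ej => le.
  apply: leq_trans (leq_trans _ (leq_mul le (leqnn (M ^ 2)))) _.
    by apply: eq_leq; ring.
  by apply: eq_leq; ring.
have le_w : \sum_(j < k.+1 | ~~ odd j) w j <= 'C(N, k).
  rewrite -[in X in _ <= X](subnKC hN) -binomial.Vandermonde.
  rewrite [X in _ <= X](bigID (fun j : 'I_k.+1 => ~~ odd j)) /=.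
  exact: leq_addr.
(* Shifting j to j+1 gives a part of Vandermonde's sum for k+1 draws out of N+2; the term of index 0
   and the odd j are dropped. *)
have le_v : \sum_(j < k.+1 | ~~ odd j) v j <= 2 * 'C(N.+2, k.+1).
  rewrite -big_distrr /= leq_mul2l /=.
  rewrite (_ : N.+2 = (2 * h).+2 + (N - 2 * h)); last by rewrite !addSn subnKC.
  rewrite -binomial.Vandermonde big_ord_recl /=; apply: leq_trans (leq_addl _ _).
  rewrite [X in _ <= X](bigID (fun j : 'I_k.+1 => ~~ odd j)) /=.
  exact: leq_addr.
have := sum_cauchy_schwarz le_wv; rewrite -cardS.
move/leq_trans/(_ (leq_mul le_w le_v)).
have := binSS_central k (N - k); rewrite subnKC; last lia.
set V := 'C(_.+2, _); set W := 'C(_, _) => eV le1.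
(* The factor N+2 cancels against N-k+1 at the cost of a 2, since 2k < N. *)
have le2 : #|S| ^ 2 * (2 * h).+1 * k.+1 <= 4 * W ^ 2 * N.+1.
  rewrite -(leq_pmul2r (_ : 0 < (N - k).+1)) //.
  have le3 := leq_mul le1 (leqnn (k.+1 * (N - k).+1)).
  apply: leq_trans (leq_trans _ le3) _; first by apply: eq_leq; ring.
  apply: (@leq_trans (2 * W * (V * (k.+1 * (N - k).+1)))); first by apply: eq_leq; ring.
  rewrite eV; apply: (@leq_trans (2 * W ^ 2 * N.+1 * N.+2)); first by apply: eq_leq; ring.
  apply: (@leq_trans (2 * W ^ 2 * N.+1 * (2 * (N - k).+1))); last by apply: eq_leq; ring.
  by rewrite leq_mul2l; apply/orP; right; lia.
rewrite -(leq_pmul2r (_ : 0 < k.+1)) //.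
apply: (@leq_trans (4 * W ^ 2 * N.+1 * k)).
  apply: leq_trans (leq_mul le2 (leqnn k)).
  rewrite -eAB; set s := #|S| ^ 2; apply: (@leq_trans (s * k.+1 * k * (2 * h))).
    by apply: eq_leq; ring.
  apply: (@leq_trans (s * k.+1 * k * (2 * h).+1)); last by apply: eq_leq; ring.
  by rewrite leq_mul2l leqnSn orbT.
apply: (@leq_trans (4 * W ^ 2 * (N.+1 * k))); first by apply: eq_leq; ring.
apply: (@leq_trans (4 * W ^ 2 * (N * k.+1))); last by apply: eq_leq; ring.
by rewrite leq_mul2l; apply/orP; right; nia.
Qed.

Local Open Scope ring_scope.

(** * The hybrid argument for phase oracles *)

Lemma le_of_eq (d : Order.disp_t) (T : porderType d) (x y : T) : x = y -> (x <= y)%O.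
Proof. by move->. Qed.

Section Hybrid.
Variables (C : numClosedFieldType) (S : finType).
Implicit Types (u v : S -> C) (f g : S -> bool).

Definition norm2 v : C := \sum_s `|v s| ^+ 2.

Lemma norm2_unitary (U : S -> S -> C) v : unitary U -> norm2 (apply_op U v) = norm2 v.
Proof.
move=> hU; rewrite /norm2 /apply_op.
under eq_bigr => s _ do rewrite normCK rmorph_sum mulr_suml.
under eq_bigr => s _ do under eq_bigr => t _ do rewrite mulr_sumr.
rewrite exchange_big /=; apply: eq_bigr => t _.
rewrite exchange_big /= (bigD1 t) //= [X in _ + X]big1 => [|t' ne].
  have h1 : \sum_r (U r t)^* * U r t = 1 by rewrite hU eqxx.
  rewrite addr0 normCK -[RHS]mul1r -h1 mulr_suml.
  apply: eq_bigr => s _; rewrite rmorphM /=; ring.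
transitivity ((U^~ t', U^~ t).1 t * 0 + v t * (v t')^* * (t' == t)%:R).
  rewrite -hU mulr_sumr mulr0 add0r.
  by apply: eq_bigr => s _; rewrite rmorphM /=; ring.
by rewrite (negbTE ne) !mulr0 addr0.
Qed.

(** After the triangle inequality, the difference of the two sides is the square of s|a| - |b|. The
    weight s is tuned later: 1/i in the induction on queries, 1/2 for success probabilities. *)
Lemma sqr_normD_le (s : C) (a b : C) : 0 < s ->
  s * `|a + b| ^+ 2 <= (1 + s) * (s * `|a| ^+ 2 + `|b| ^+ 2).
Proof.
move=> s0; apply: (@le_trans _ _ (s * (`|a| + `|b|) ^+ 2)).
  by rewrite ler_pM2l // lerXn2r ?nnegrE ?addr_ge0 // ler_normD.
rewrite -subr_ge0.
rewrite (_ : _ - _ = (s * `|a| - `|b|) ^+ 2); last by ring.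
by rewrite real_exprn_even_ge0 // rpredB // ?normr_real // rpredM ?normr_real // gtr0_real.
Qed.

Definition phase f v : S -> C := fun s => (if f s then -1 else 1) * v s.

(** The answers come from an arbitrary predicate on basis states, which admits a reference oracle
    that no x induces. *)
Fixpoint phase_run (U : nat -> S -> S -> C) psi0 f i : S -> C :=
  match i with
  | 0 => apply_op (U 0%N) psi0
  | i'.+1 => apply_op (U i) (phase f (phase_run U psi0 f i'))
  end.

Lemma norm2_phase f v : norm2 (phase f v) = norm2 v.
Proof.
apply: eq_bigr => s _; rewrite /phase normrM.
by case: (f s); rewrite ?normrN normr1 mul1r.
Qed.

Lemma norm2_phase_run (U : nat -> S -> S -> C) psi0 f i :
  (forall j, (j <= i)%N -> unitary (U j)) ->
  norm2 (phase_run U psi0 f i) = norm2 psi0.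
Proof.
elim: i => [|i IHi] hU /=; first by rewrite norm2_unitary //; apply: hU.
by rewrite norm2_unitary ?norm2_phase ?IHi // => [j ji|]; apply: hU => //; lia.
Qed.

(** One more query adds to the old difference [d] an error [e] living where f and g differ, of
    amplitude twice that of the g-run. Weight s = 1/i gives D_(i+1) <= (1 + 1/i) D_i + (i+1) |e|^2,
    which keeps the prefactor linear in i. *)
Lemma phase_run_diff (U : nat -> S -> S -> C) psi0 f g i :
  (forall j, (j <= i)%N -> unitary (U j)) ->
  norm2 (fun s => phase_run U psi0 f i s - phase_run U psi0 g i s)
  <= i%:R * \sum_(j < i) \sum_(s | f s != g s) 4 * `|phase_run U psi0 g j s| ^+ 2.
Proof.
elim: i => [|i IHi] hU /=.
  by rewrite big_ord0 mulr0 /norm2 big1 // => s _; rewrite subrr normr0 expr0n.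
pose d s := phase_run U psi0 f i s - phase_run U psi0 g i s.
pose e s := phase f (phase_run U psi0 g i) s - phase g (phase_run U psi0 g i) s.
have dE : norm2 (fun s => phase_run U psi0 f i.+1 s - phase_run U psi0 g i.+1 s)
        = norm2 (fun s => phase f d s + e s).
  rewrite -[RHS](norm2_unitary _ (hU i.+1 (leqnn _))); apply: eq_bigr => s _ /=.
  rewrite /apply_op -sumrB; congr (`|_| ^+ 2); apply: eq_bigr => t _.
  by rewrite /e /d /phase; ring.
have eE : norm2 e = \sum_(s | f s != g s) 4 * `|phase_run U psi0 g i s| ^+ 2.
  rewrite big_mkcond; apply: eq_bigr => s _; rewrite /e /phase.
  rewrite -mulrBl normrM exprMn.
  by case: (f s); case: (g s) => /=; rewrite ?subrr ?normr0 ?expr0n ?mul0r //;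
    [rewrite -opprD normrN|rewrite opprK]; rewrite -[1 + 1]/(2%:R : C) normr_nat -natrX.
have {}IHi : norm2 d <= _ := IHi (fun j ji => hU j (leqW ji)).
rewrite big_ord_recr /= -eE [X in X <= _]dE.
set B := \sum_(_ < i) _ in IHi *.
(* The weight 1/i needs i > 0; at the first query [d] vanishes. *)
have [i0|i_gt0] := posnP i.
  rewrite /B i0 big_ord0 add0r mul1r; apply: le_of_eq; apply: eq_bigr => s _.
  by rewrite /d i0 /phase subrr mulr0 add0r.
have i0 : 0 < (i%:R)^-1 :> C by rewrite invr_gt0 ltr0n.
rewrite -(ler_pM2l i0).
apply: (@le_trans _ _ ((1 + i%:R^-1) * (i%:R^-1 * norm2 (phase f d) + norm2 e))).
  rewrite /norm2 !mulr_sumr -big_split /= !mulr_sumr.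
  by apply: ler_sum => s _; apply: sqr_normD_le.
have i_neq0 : i%:R != 0 :> C by rewrite pnatr_eq0 -lt0n.
rewrite norm2_phase [X in _ <= X]mulrA -[i.+1%:R]natr1.
rewrite [_^-1 * (_ + 1)]mulrDr mulVf // mulr1.
rewrite ler_pM2l ?ltr_wpDl // lerD2r.
by rewrite -(ler_pM2l (_ : 0 < i%:R)) ?ltr0n // mulVKf.
Qed.


(** The reference run ignores x, so its success probabilities over [D] sum to at most 1; runs that
    all succeed must therefore deviate from it, while the total deviation is at most 4 T^2 b. *)
Lemma hybrid_bound (X : finType) (D : {set X}) (F : X -> S -> bool) (g : S -> bool)
    (out : S -> X) (U : nat -> S -> S -> C) psi0 (T b : nat) :
  (forall i, (i <= T)%N -> unitary (U i)) -> normalized psi0 ->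
  (2 < #|D|)%N ->
  (forall s, #|[set x in D | F x s != g s]| <= b)%N ->
  (forall x, x \in D ->
    2%:R / 3%:R <= \sum_(s | out s == x) `|phase_run U psi0 (F x) T s| ^+ 2) ->
  (#|D| <= 72 * T ^ 2 * b)%N.
Proof.
move=> hU n0 D3 hb succ.
pose r := phase_run U psi0 g.
have nr t : (t <= T)%N -> norm2 (r t) = 1.
  by move=> tT; rewrite norm2_phase_run // => j jt; apply: hU; apply: leq_trans tT.
pose dev x := norm2 (fun s => phase_run U psi0 (F x) T s - r T s).
have dev_sum : \sum_(x in D) dev x <= (4 * T ^ 2 * b)%:R.
  apply: (@le_trans _ _ (\sum_(x in D) T%:R * \sum_(j < T)
      \sum_(s | F x s != g s) 4 * `|r j s| ^+ 2)).
    by apply: ler_sum => x _; apply: phase_run_diff.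
  rewrite -mulr_sumr exchange_big /=.
  rewrite (_ : (4 * T ^ 2 * b)%N = (T * \sum_(j < T) (4 * b))%N); last first.
    by rewrite sum_nat_const card_ord; ring.
  rewrite natrM ler_wpM2l // natr_sum; apply: ler_sum => j _.
  (* Summing over x first, each basis state is charged at most b times, and each reference state has
     norm 1. *)
  under eq_bigr => x _ do rewrite big_mkcond.
  rewrite exchange_big /= -[X in _ <= X]mulr1 -[X in _ <= _ * X](nr j (ltnW (ltn_ord j))) mulr_sumr.
  apply: ler_sum => s _.
  rewrite -big_mkcondr /= sumr_const.
  rewrite -[X in X <= _]mulr_natl mulrA ler_wpM2r ?exprn_ge0 //.
  rewrite -natrM ler_nat mulnC leq_mul2l /=.
  by apply: leq_trans (hb s); rewrite cardsE.
have succ_ref : \sum_(x in D) \sum_(s | out s == x) `|r T s| ^+ 2 <= 1.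
  rewrite -(nr T (leqnn _)) /norm2 (partition_big out predT) //=.
  rewrite [X in _ <= X](bigID (mem D)) /= lerDl.
  by apply: sumr_ge0 => x _; apply: sumr_ge0 => s _; apply: exprn_ge0.
(* Weight 1/2 gives |u|^2 <= (3/2)|r|^2 + 3|u-r|^2; a factor 6 clears the denominators. *)
have succ_le x : x \in D ->
    4 <= 9 * (\sum_(s | out s == x) `|r T s| ^+ 2) + 18 * dev x.
  move=> /succ le; apply: (@le_trans _ _ (6 * (2%:R / 3%:R))).
    by rewrite (_ : 6 * _ = 4) //; field.
  apply: (@le_trans _ _ (6 * \sum_(s | out s == x) `|phase_run U psi0 (F x) T s| ^+ 2)).
    by rewrite ler_wpM2l.
  rewrite /dev /norm2 [X in 18 * X](bigID (fun s => out s == x)) /= mulrDr addrA.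
  apply: ler_wpDr.
    by rewrite mulr_ge0 //; apply: sumr_ge0 => s _; apply: exprn_ge0.
  rewrite !mulr_sumr -big_split /=; apply: ler_sum => s _.
  have half_gt0 : 0 < 2^-1 :> C by rewrite invr_gt0.
  have := sqr_normD_le (r T s) (phase_run U psi0 (F x) T s - r T s) half_gt0.
  rewrite subrKC => le_s; rewrite -(ler_pM2l (_ : 0 < 12)) // in le_s.
  have -> : 6 * `|phase_run U psi0 (F x) T s| ^+ 2
      = 12 * (2^-1 * `|phase_run U psi0 (F x) T s| ^+ 2) by field.
  by apply: le_trans le_s _; apply: le_of_eq; field.
have : \sum_(x in D) (4 : C) <= (9 + 18 * (4 * T ^ 2 * b))%:R.
  apply: le_trans (ler_sum _ succ_le) _.
  rewrite big_split /= -!mulr_sumr natrD natrM; apply: lerD; last by rewrite ler_wpM2l.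
  by apply: le_trans (ler_wpM2l _ succ_ref) _; rewrite ?mulr1.
(* From 4|D| <= 9 + 72 T^2 b, the 9 is absorbed by 3|D|. *)
by rewrite sumr_const -mulrnA ler_nat; nia.
Qed.

End Hybrid.

(** * Counting the inputs that give a query each answer *)

Lemma card_bigcup_le (I T : finType) (P : pred I) (F : I -> {set T}) :
  (#|\bigcup_(i | P i) F i| <= \sum_(i | P i) #|F i|)%N.
Proof.
elim/big_rec2: _ => [|i n X _ le]; first by rewrite cards0.
by apply: leq_trans (leq_card_setU _ _) _; rewrite leq_add2l.
Qed.

Section Coins.
Variable N : nat.
Implicit Types (x : {ffun 'I_N -> bool}) (q : qstring N).

Definition false_coins x : {set 'I_N} := [set i | x i].
Definition left_pan q : {set 'I_N} := [set i | pan_val (q i) == 1].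
Definition right_pan q : {set 'I_N} := [set i | pan_val (q i) == -1].

Lemma card_false_coins (P : pred {set 'I_N}) :
  #|[set x : {ffun 'I_N -> bool} | P (false_coins x)]| = #|[set X | P X]|.
Proof.
rewrite -(@on_card_preimset _ _ false_coins [set X | P X]).
  by apply: eq_card => x; rewrite !inE.
exists (fun X : {set 'I_N} => [ffun i => i \in X]) => [x _|X _].
  by apply/ffunP => i; rewrite ffunE inE.
by apply/setP => i; rewrite inE ffunE.
Qed.

Lemma wtE x : wt x = #|false_coins x|.
Proof. by apply: eq_card => i; rewrite !inE. Qed.

Lemma card_wt k : #|[set x : {ffun 'I_N -> bool} | wt x == k]| = 'C(N, k).
Proof.
transitivity #|[set x : {ffun 'I_N -> bool} | #|false_coins x| == k]|.
  by apply: eq_card => x; rewrite !inE wtE.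
rewrite (card_false_coins (fun X => #|X| == k)) -[N in RHS]card_ord -cardsT.
by rewrite -cards_draws; apply: eq_card => X; rewrite !inE subsetT.
Qed.

Lemma pan_valE (a : 'I_3) : pan_val a = (pan_val a == 1)%:Z - (pan_val a == -1)%:Z.
Proof. by case: a => [[|[|[|]]]]. Qed.

Lemma disjoint_pans q : [disjoint left_pan q & right_pan q].
Proof.
rewrite disjoint_subset; apply/subsetP => i.
by rewrite !inE => /eqP->.
Qed.

Lemma chiE x q :
  chi x q = (#|false_coins x :&: left_pan q| != #|false_coins x :&: right_pan q|).
Proof.
rewrite /chi; have -> : \sum_(i < N) pan_val (q i) * (x i)%:Z
    = #|false_coins x :&: left_pan q|%:Z - #|false_coins x :&: right_pan q|%:Z.
  have cardZ (A : {set 'I_N}) : #|A|%:Z = \sum_i (i \in A)%:Z.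
    rewrite -sum1_card -natz natr_sum big_mkcond; apply: eq_bigr => i _.
    by case: (i \in A).
  rewrite !cardZ -sumrB.
  apply: eq_bigr => i _; rewrite !inE {1}pan_valE.
  by case: (x i) => /=; rewrite ?mulr0 ?subr0 // mulr1; do 2!case: eqP.
by rewrite subr_eq0.
Qed.

Lemma card_left_right q : balanced_query q -> #|left_pan q| = #|right_pan q|.
Proof. by move=> /eqP e; rewrite /left_pan /right_pan !cardsE. Qed.

Lemma ncoinsE q : ncoins q = (#|left_pan q| + #|right_pan q|)%N.
Proof.
rewrite -cardsUI (_ : _ :&: _ = set0); last first.
  by apply/eqP; rewrite setI_eq0 disjoint_pans.
rewrite cards0 addn0; apply: eq_card => i; rewrite !inE.
by case: (q i) => [[|[|[|]]]].
Qed.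

Lemma card_balanced_chi k q : balanced_query q -> (2 * k < N)%N ->
  (#|[set x : {ffun 'I_N -> bool} | (wt x == k) && ~~ chi x q]| ^ 2 * (ncoins q * k)
   <= 4 * N * 'C(N, k) ^ 2)%N.
Proof.
move=> bq kN; rewrite ncoinsE -[N in 'C(N, _)]card_ord -[X in (4 * X)%N]card_ord.
apply: leq_trans (card_balanced_le (disjoint_pans q) (card_left_right bq) _);
  last by rewrite card_ord.
rewrite leq_mul2r leq_sqr; apply/orP; right.
rewrite -card_false_coins; apply: subset_leq_card; apply/subsetP => x.
by rewrite !inE wtE chiE negbK.
Qed.

(** Each coin is false with probability k/N: fixing coin i leaves 'C(N-1, k-1) choices. *)
Lemma card_wt_coin k (i : 'I_N) :
  (N * #|[set x : {ffun 'I_N -> bool} | (wt x == k) && x i]| = k * 'C(N, k))%N.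
Proof.
case: k => [|k].
  rewrite mul0n (_ : [set x : {ffun 'I_N -> bool} | _] = set0) ?cards0 ?muln0 //.
  apply/setP => x; rewrite !inE; apply/negP => /andP[/eqP].
  by rewrite wtE => /eqP; rewrite cards_eq0 => /eqP/setP/(_ i); rewrite !inE => ->.
rewrite -mul_bin_diag; congr (_ * _)%N.
transitivity #|[set x : {ffun 'I_N -> bool} | [&& #|false_coins x :&: [set i]| == 1%N,
   #|false_coins x :&: set0| == 0%N & #|false_coins x| == (1 + 0 + k)%N]]|.
  apply: eq_card => x; rewrite !inE wtE setI0 cards0 eqxx /= andbC; congr (_ && _).
  case: (boolP (x i)) => xi.
    by rewrite (setIidPr _) ?cards1 // sub1set inE.
  rewrite (_ : _ :&: _ = set0) ?cards0 //; apply/setP => j; rewrite !inE.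
  by case: eqP => [->|]; rewrite ?andbF // (negbTE xi).
rewrite (card_false_coins (fun X => [&& #|X :&: [set i]| == 1%N,
   #|X :&: set0| == 0%N & #|X| == (1 + 0 + k)%N])).
rewrite card_draws_split; last by rewrite disjoints1 inE.
by rewrite cards1 cards0 card_ord !mul1n addn0 subn1.
Qed.

(** An unbalanced query has a false coin on its pans; a union bound over these coins follows. *)
Lemma card_unbalanced_chi k q :
  (#|[set x : {ffun 'I_N -> bool} | (wt x == k) && chi x q]| * N <= ncoins q * k * 'C(N, k))%N.
Proof.
set pans := left_pan q :|: right_pan q.
have le : (#|[set x : {ffun 'I_N -> bool} | (wt x == k) && chi x q]|
    <= \sum_(i in pans) #|[set x : {ffun 'I_N -> bool} | (wt x == k) && x i]|)%N.
  apply: leq_trans (card_bigcup_le _ _).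
  apply: subset_leq_card; apply/subsetP => x; rewrite !inE => /andP[wx].
  rewrite chiE => ne.
  have [j] : exists j, j \in false_coins x :&: pans.
    apply/set0Pn; apply: contraNneq ne => e0.
    have e1 (A : {set 'I_N}) : A \subset pans -> false_coins x :&: A = set0.
      by move=> sA; apply/eqP; rewrite -subset0 -e0 setIS.
    by rewrite !e1 ?subsetUl ?subsetUr.
  rewrite inE => /andP[xj jp]; apply/bigcupP; exists j => //.
  by move: xj; rewrite !inE wx => ->.
apply: leq_trans (leq_mul le (leqnn N)) _.
rewrite big_distrl /=.
under eq_bigr => i _ do rewrite mulnC card_wt_coin.
rewrite sum_nat_const -!mulnA leq_mul2r; apply/orP; right.
by rewrite ncoinsE leq_card_setU.
Qed.

End Coins.

(** * From the counts to the query lower bounds *)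

Lemma leq_bin n k : (0 < k < n)%N -> (n <= 'C(n, k))%N.
Proof.
elim: n k => [|n IHn] [|k] //= kn.
have [->|nk] := eqVneq n k.+1; first by rewrite binSn.
have b0 : (0 < 'C(n, k))%N by rewrite bin_gt0; lia.
by have := IHn k.+1; rewrite binS; lia.
Qed.

Lemma run_phase_run (C : numClosedFieldType) N P m
    (U : nat -> St N P m -> St N P m -> C) psi0 x i :
  run U psi0 x i = phase_run U psi0 (fun s => chi x (val s.1)) i.
Proof. by elim: i => //= i ->. Qed.

(** The reference answers by size alone, with [small] left free to suit either threshold; n is the
    size of a query that contradicts the reference on the most inputs. *)
Lemma exists_informative_query (C : numClosedFieldType) (N k m T : nat)
    (P small : pred nat) (U : nat -> St N P m -> St N P m -> C) psi0 out :
  (0 < k)%N -> (2 * k < N)%N -> identifies_wt k T U psi0 out ->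
  exists n : nat, P n /\
    (if small n then N <= 72 * T ^ 2 * (n * k)
     else n * k <= (144 * T ^ 2) ^ 2 * N)%N.
Proof.
move=> k0 kN [n0 hU succ].
pose D := [set x : {ffun 'I_N -> bool} | wt x == k].
pose g (q : Query N P) := ~~ small (ncoins (val q)).
pose bad (q : Query N P) := #|[set x in D | chi x (val q) != g q]|.
(* Without admissible queries the state space is empty and carries no normalized state. *)
have Q0 : (0 < #|{: Query N P}|)%N.
  rewrite lt0n; apply/negP => /eqP/card0_eq Q0.
  have : (0 : C) = 1.
    by rewrite -n0 big1 // => -[q s] _; have := Q0 q; rewrite inE.
  by move/eqP; rewrite eq_sym oner_eq0.
have [q bad_q] := bigop.eq_bigmax bad Q0.
have cardD : #|D| = 'C(N, k) := card_wt N k.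
have D0 : (0 < #|D|)%N by rewrite cardD bin_gt0; lia.
have le : (#|D| <= 72 * T ^ 2 * bad q)%N.
  apply: (@hybrid_bound C (St N P m) _ D (fun x s => chi x (val s.1))
    (fun s => g s.1) out U psi0) => //.
  (* Here k >= 1 and 2k < N force N >= 3. *)
  - by rewrite cardD; apply: leq_trans (leq_bin _); lia.
  - by move=> s; rewrite -bad_q; apply: (leq_bigmax s.1).
  move=> x; rewrite inE => /eqP /succ; rewrite /success_prob.
  by under eq_bigr => s _ do rewrite run_phase_run.
have /andP[bal_q Pq] := valP q.
exists (ncoins (val q)); split=> //; rewrite /bad /g in le.
case: ifP => sm; rewrite sm /= in le.
  have bad_le := card_unbalanced_chi k (val q).
  rewrite -cardD (_ : [set x | _] = [set x in D | chi x (val q) != false]) in bad_le; last first.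
    by apply/setP => x; rewrite !inE; case: chi.
  rewrite -(leq_pmul2l D0); apply: leq_trans (leq_mul le (leqnn N)) _.
  rewrite -mulnA; apply: leq_trans (leq_mul (leqnn _) bad_le) _.
  by apply: eq_leq; ring.
have bad_le := card_balanced_chi bal_q kN.
rewrite -cardD (_ : [set x | _] = [set x in D | chi x (val q) != true]) in bad_le; last first.
  by apply/setP => x; rewrite !inE; case: chi.
rewrite -(leq_pmul2l (_ : 0 < #|D| ^ 2)%N) ?expn_gt0 ?D0 //.
have le2 : (#|D| ^ 2 <= (72 * T ^ 2) ^ 2 * #|[set x in D | chi x (val q) != true]| ^ 2)%N.
  by rewrite -expnMn leq_sqr.
apply: leq_trans (leq_mul le2 (leqnn _)) _.
rewrite -mulnA; apply: leq_trans (leq_mul (leqnn _) bad_le) _.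
by apply: eq_leq; ring.
Qed.

Theorem theorem6 :
  (exists c : rat, 0 < c /\
    forall (R : realType) (N k l1 l2 m T : nat)
      (U : nat -> St N (coin_restr l1 l2) m -> St N (coin_restr l1 l2) m -> R[i])
      (psi0 : St N (coin_restr l1 l2) m -> R[i])
      (out : St N (coin_restr l1 l2) m -> {ffun 'I_N -> bool}),
      (1 <= k)%N -> (2 * k < N)%N -> (l1 < l2)%N ->
      identifies_wt k T U psi0 out ->
      ratr c * Num.min (Num.sqrt (N%:R / (l1%:R * k%:R)))
                       (Num.sqrt (Num.sqrt (l2%:R * k%:R / N%:R))) <= (T%:R : R))
  /\
  (forall (R : realType) (eps : R), 0 <= eps ->
    exists c : R, 0 < c /\
    forall (N k m T : nat),
      let P : pred nat := fun n =>
        (n%:R <= N%:R / (k%:R `^ (1 + 2 * eps) : R)) ||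
        (N%:R / (k%:R `^ (1 - 4 * eps) : R) <= n%:R) in
      forall (U : nat -> St N P m -> St N P m -> R[i])
        (psi0 : St N P m -> R[i]) (out : St N P m -> {ffun 'I_N -> bool}),
      (1 <= k)%N -> (2 * k < N)%N ->
      identifies_wt k T U psi0 out ->
      c * (k%:R `^ eps) <= (T%:R : R)).
Proof.
have sqrt_le (R : realType) (x y : R) : 0 <= y -> x <= y ^+ 2 -> Num.sqrt x <= y.
  by move=> y0 xy; rewrite -[y]ger0_norm // -sqrtr_sqr ler_wsqrtr.
split.
  (* With 72 rounded up to 144 = 12^2, the two cases read N <= (12T)^2 l1 k and l2 k <= (12T)^4
     N. *)
  exists (12%:R)^-1; split=> // R N k l1 l2 m T U psi0 out k0 kN l12.
  move=> /(exists_informative_query (fun n => n <= l1)%N k0 kN).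
  rewrite fmorphV rmorph_nat mulrC ler_pdivrMr // => -[n []].
  have T0 : 0 <= T%:R * 12 :> R by rewrite mulr_ge0.
  rewrite /coin_restr; case: leqP => /= nl1.
    move=> _ le; rewrite ge_min; apply/orP; left; apply: sqrt_le => //.
    (* For l1 = 0 the quotient is 0 by the convention on inverses. *)
    have [l1k0|l1k0] := posnP (l1 * k)%N.
      by rewrite -natrM l1k0 invr0 mulr0 exprn_ge0.
    rewrite -natrM ler_pdivrMr ?ltr0n //.
    have {}le : (N <= (T * 12) ^ 2 * (l1 * k))%N.
      apply: leq_trans le _; apply: leq_mul; last by rewrite leq_mul2r nl1 orbT.
      by rewrite expnMn mulnC leq_mul2l orbT.
    by rewrite -natrM -natrX -natrM ler_nat.
  move=> l2n le; rewrite ge_min; apply/orP; right.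
  apply: (sqrt_le) => //; apply: sqrt_le; first exact: exprn_ge0.
  have {}le : (l2 * k <= ((T * 12) ^ 2) ^ 2 * N)%N.
    apply: leq_trans (leq_trans _ le) _; first by rewrite leq_mul2r l2n orbT.
    by apply: eq_leq; ring.
  rewrite ler_pdivrMr ?ltr0n; last lia.
  by rewrite -!natrM -!natrX -natrM ler_nat.
move=> R eps eps0; exists (12%:R)^-1; split; first by rewrite invr_gt0.
move=> N k m T P U psi0 out k0 kN.
have kR0 : 0 < k%:R :> R by rewrite ltr0n.
have kR_neq0 : k%:R != 0 :> R by rewrite gt_eqF.
have NR0 : 0 < N%:R :> R by rewrite ltr0n; lia.
(* In terms of y the thresholds are N/(k y^2) and N y^4/k, so the two cases give y^2 <= (12T)^2 and
   y^4 <= (12T)^4. *)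
pose y : R := k%:R `^ eps; have y0 : 0 < y by apply: powR_gt0.
have powD : k%:R `^ (1 + 2 * eps) = k%:R * y ^+ 2 :> R.
  rewrite powRD; last by rewrite kR_neq0 implybT.
  by rewrite powRr1 ?ler0n // -powR_mulrn ?powR_ge0 // -powRrM (mulrC eps).
have powB : k%:R `^ (1 - 4 * eps) = k%:R / y ^+ 4 :> R.
  rewrite powRB; last by rewrite kR_neq0 implybT.
  by rewrite powRr1 ?ler0n // -powR_mulrn ?powR_ge0 // -powRrM (mulrC eps).
(* Real thresholds are compared with n directly, which also covers eps = 0, where they coincide. *)
move=> /(exists_informative_query (fun n => n%:R <= N%:R / (k%:R `^ (1 + 2 * eps) : R)) k0 kN).
move=> [n [Pn le_n]]; rewrite mulrC ler_pdivrMr // -/y.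
move: Pn le_n; rewrite /P powD powB.
have T0 : 0 <= T%:R * 12 :> R by rewrite mulr_ge0.
case: ifP => /= nl1.
  move=> _ le_nat.
  have le : N%:R <= 72 * T%:R ^+ 2 * (n%:R * k%:R) :> R.
    by rewrite -natrX -!natrM ler_nat.
  rewrite -ler_sqr ?nnegrE ?(ltW y0) //.
  rewrite ler_pdivlMr ?mulr_gt0 ?exprn_gt0 // in nl1.
  rewrite -(ler_pM2r NR0).
  apply: (@le_trans _ _ (72 * T%:R ^+ 2 * (n%:R * (k%:R * y ^+ 2)))).
    rewrite (_ : _ * (n%:R * _) = y ^+ 2 * (72 * T%:R ^+ 2 * (n%:R * k%:R))); last by ring.
    by rewrite ler_pM2l ?exprn_gt0.
  apply: (@le_trans _ _ (72 * T%:R ^+ 2 * N%:R)).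
    by rewrite ler_wpM2l // mulr_ge0 ?exprn_ge0.
  by rewrite ler_pM2r // exprMn mulrC ler_wpM2l ?exprn_ge0 // -natrX ler_nat.
move=> nl2 le_nat.
have le : n%:R * k%:R <= (144 * T%:R ^+ 2) ^+ 2 * N%:R :> R.
  by rewrite -(natrX _ T) -!natrM -natrX -natrM ler_nat.
rewrite -(@ler_pXn2r _ 4) ?nnegrE ?(ltW y0) //.
rewrite -(ler_pM2r NR0).
have -> : y ^+ 4 * N%:R = N%:R / (k%:R / y ^+ 4) * k%:R.
  by field; rewrite !gt_eqF.
apply: (@le_trans _ _ (n%:R * k%:R)); first by rewrite ler_pM2r.
by apply: le_trans le _; apply: le_of_eq; ring.
Qed.
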